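(* Let $d$ be a positive integer. Suppose that every $d$-uniform decomposable clutter is chordal (i.e. $\mathfrak{C}'_d\subset\mathfrak{C}_d$, where $\mathfrak{C}'_d$ and $\mathfrak{C}_d$ denote the classes of $d$-uniform decomposable, respectively chordal, clutters, and $\subset$ means containment, not necessarily proper). Then for every integer $n\ge d$ the skeleton $\langle[n]\rangle^{(n-d)}$ is extendably shellable.
   Context: A clutter $\mathcal{C}$ on a finite vertex set $V$ is a collection of subsets of $V$ (called circuits) none of which is contained in another; it is $d$-uniform if every circuit has exactly $d$ elements. Write $V(\mathcal{C})$ for its vertex set (which may contain vertices lying in no circuit). A subclutter is a subset of $\mathcal{C}$ (on the same vertex set). The complete $d$-uniform clutter $\mathcal{C}_{n,d}$ on a vertex set $V$ with $|V|=n$ is $\{F\subseteq V: |F|=d\}$; if $n<d$ it consists of $n$ isolated vertices and no circuits. A subset $F\subseteq V$ is a clique in the $d$-uniform clutter $\mathcal{C}$ if either $|F|<d$ or all $d$-subsets of $F$ belong to $\mathcal{C}$. For a $(d-1)$-subset $e$ of $V$, let $N_{\mathcal{C}}[e]=e\cup\{c\in V: e\cup\{c\}\in\mathcal{C}\}$; $e$ is simplicial over $\mathcal{C}$ if $N_{\mathcal{C}}[e]$ is a clique in $\mathcal{C}$, and $e$ is a maximal subcircuit of $\mathcal{C}$ if $N_{\mathcal{C}}[e]\ne e$. A simplicial maximal subcircuit is a maximal subcircuit that is simplicial over $\mathcal{C}$. The deletion of $e$ is $\mathcal{C}\setminus e=\{F\in\mathcal{C}: e\nsubseteq F\}$. For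 a sequence $\mathbf{e}=e_1,\ldots,e_t$ of $(d-1)$-subsets put $\mathcal{C}_{\mathbf{e}}^0=\mathcal{C}$ and $\mathcal{C}_{\mathbf{e}}^i=(\mathcal{C}\setminus e_1)\setminus\cdots\setminus e_i$. Chordal clutters: a $d$-uniform clutter $\mathcal{C}$ is chordal if either $\mathcal{C}=\varnothing$, or $\mathcal{C}$ has a simplicial maximal subcircuit $e$ such that $\mathcal{C}\setminus e$ is chordal. Simplicial subclutter: a subclutter $\mathcal{D}\subsetneq\mathcal{C}$ is a simplicial subclutter of $\mathcal{C}$ if there are $(d-1)$-subsets $\mathbf{e}=e_1,\ldots,e_t$ of $V$ and sets $A_i\subseteq\{F\in\mathcal{C}_{\mathbf{e}}^{i-1}: e_i\subset F\}$, $i=1,\ldots,t$, such that $e_1$ is simplicial over $\mathcal{C}$, $e_i$ is simplicial over $\mathcal{C}\setminus A_1\setminus\cdots\setminus A_{i-1}$ for $i>1$ (set difference), and $\mathcal{D}=\mathcal{C}\setminus A_1\setminus\cdots\setminus A_t$. Decomposable clutters: the class of $d$-uniform decomposable clutters is defined recursively by: (i) $\mathcal{C}_{n,d}$ is decomposable; (ii) if $\mathcal{D}=\mathcal{C}_1\cup\mathcal{C}_2$ (on vertex set $V(\mathcal{C}_1)\cup V(\mathcal{C}_2)$), where $\mathcal{C}_1,\mathcal{C}_2$ are $d$-uniform decomposable clutters on $V(\mathcal{C}_1),V(\mathcal{C}_2)$ with $V(\mathcal{C}_1)\nsubseteq V(\mathcal{C}_2)$, $V(\mathcal{C}_2)\nsubseteq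 V(\mathcal{C}_1)$ and $V(\mathcal{C}_1)\cap V(\mathcal{C}_2)$ a clique in both $\mathcal{C}_1$ and $\mathcal{C}_2$, then $\mathcal{D}$ is decomposable; (iii) every simplicial subclutter of a decomposable clutter is decomposable. Simplicial complexes: $\langle F_1,\ldots,F_t\rangle$ denotes the complex with facets $F_1,\ldots,F_t$, so $\langle[n]\rangle$ is the full simplex on $[n]=\{1,\dots,n\}$; $\Delta^{(i)}$ is the $i$-th skeleton, consisting of all faces of $\Delta$ of dimension (cardinality minus one) at most $i$. A shelling of a simplicial complex is a total order $F_1,\ldots,F_t$ of its facets such that $\langle F_1,\ldots,F_{i-1}\rangle\cap\langle F_i\rangle$ is generated by a non-empty set of maximal proper faces of $F_i$ for $2\le i\le t$. A complex $\Delta$ is extendably shellable if any shelling $F_1,\ldots,F_s$ of a subcomplex $\Gamma$ whose facets are all facets of $\Delta$ can be continued to a shelling $F_1,\ldots,F_s,F_{s+1},\ldots,F_t$ of $\Delta$. *)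

(* Defs.v *)
From mathcomp Require Import all_boot.

Set Implicit Arguments.
Unset Strict Implicit.
Unset Printing Implicit Defensive.

(* A clutter is given by its vertex set [V], which may contain vertices lying
   in no circuit, and its set of circuits [C], inside an ambient finite type. *)
Section Clutters.

Variable T : finType.
Implicit Types (V F e : {set T}) (C D : {set {set T}}).

Definition ksubsets V (k : nat) : {set {set T}} :=
  [set F : {set T} | (F \subset V) && (#|F| == k)].

Definition is_clutter V C : Prop :=
  (forall F, F \in C -> F \subset V) /\
  (forall F G, F \in C -> G \in C -> F \subset G -> F = G).

Definition uniform_clutter (d : nat) V C : Prop :=
  is_clutter V C /\ (forall F, F \in C -> #|F| = d).

Definition complete_clutter (d : nat) V : {set {set T}} := ksubsets V d.

Definition clique (d : nat) V C F : Prop :=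
  F \subset V /\ (#|F| < d \/ ksubsets F d \subset C).

Definition closed_nbhd V C e : {set T} :=
  e :|: [set c in V | e :|: [set c] \in C].

Definition simplicial (d : nat) V C e : Prop :=
  e \in ksubsets V d.-1 /\ clique d V C (closed_nbhd V C e).

Definition maximal_subcircuit (d : nat) V C e : Prop :=
  e \in ksubsets V d.-1 /\ closed_nbhd V C e <> e.

Definition deletion C e : {set {set T}} := [set F in C | ~~ (e \subset F)].

Inductive chordal (d : nat) V : {set {set T}} -> Prop :=
| chordal_empty : chordal d V set0
| chordal_deletion C e :
    maximal_subcircuit d V C e -> simplicial d V C e ->
    chordal d V (deletion C e) -> chordal d V C.

(* With [es] = e_1, ..., e_t and [As] = A_1, ..., A_t indexed from 0, the two
   left folds are C \ e_1 \ ... \ e_i (deletions) and C \ A_1 \ ... \ A_i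
   (set differences). *)
Definition simplicial_subclutter (d : nat) V C D : Prop :=
  D \proper C /\
  exists (es : seq {set T}) (As : seq {set {set T}}),
    [/\ size As = size es,
        (forall i : nat, i < size es ->
           [/\ nth set0 es i \in ksubsets V d.-1,
               nth set0 As i \subset
                 [set F in foldl deletion C (take i es)
                    | nth set0 es i \subset F]
             & simplicial d V (foldl (fun X Y => X :\: Y) C (take i As))
                 (nth set0 es i)])
      & D = foldl (fun X Y => X :\: Y) C As].

Inductive decomposable (d : nat) : {set T} -> {set {set T}} -> Prop :=
| decomposable_complete V : decomposable d V (complete_clutter d V)
| decomposable_union V1 C1 V2 C2 :
    decomposable d V1 C1 -> decomposable d V2 C2 ->
    ~~ (V1 \subset V2) -> ~~ (V2 \subset V1) ->
    clique d V1 C1 (V1 :&: V2) -> clique d V2 C2 (V1 :&: V2) ->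
    decomposable d (V1 :|: V2) (C1 :|: C2)
| decomposable_simplicial V C D :
    decomposable d V C -> simplicial_subclutter d V C D ->
    decomposable d V D.

End Clutters.

Section SimplicialComplexes.

Variable T : finType.
Implicit Types (F G : {set T}) (S Delta Gamma : {set {set T}}).

Definition is_complex Delta : Prop :=
  forall F G, F \in Delta -> G \subset F -> G \in Delta.

Definition facets Delta : {set {set T}} :=
  [set F | maxset (fun G : {set T} => G \in Delta) F].

Definition complex_of S : {set {set T}} :=
  [set F : {set T} | [exists G in S, F \subset G]].

(* The dimension of a face is its cardinality minus one. *)
Definition skeleton (i : nat) Delta : {set {set T}} :=
  [set F in Delta | #|F| <= i.+1].

Definition max_proper_faces F : {set {set T}} :=
  [set G | maxset (fun H : {set T} => H \proper F) G].

Definition shelling Delta (Fs : seq {set T}) : Prop :=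
  [/\ uniq Fs, Fs =i facets Delta
    & forall i : nat, 0 < i < size Fs ->
        exists S : {set {set T}},
          [/\ S != set0, S \subset max_proper_faces (nth set0 Fs i)
            & complex_of [set G in take i Fs] :&:
              complex_of [set nth set0 Fs i] = complex_of S]].

Definition extendably_shellable Delta : Prop :=
  forall (Gamma : {set {set T}}) (Fs : seq {set T}),
    is_complex Gamma -> Gamma \subset Delta ->
    facets Gamma \subset facets Delta -> shelling Gamma Fs ->
    exists Gs : seq {set T}, shelling Delta (Fs ++ Gs).

End SimplicialComplexes.

(* Main.v *)
Require Import Defs.
From mathcomp Require Import all_boot zify.

(** Facets of the [(n - d)]-skeleton of the simplex on [n] vertices have
    [n - d + 1] elements, so their complements are the [(d-1)]-subsets, which
    are the candidates for deletion in a [d]-uniform clutter.  Under this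
    correspondence, adding a facet to a non-empty shelling is the same thing as
    deleting a simplicial subset.  Indeed both conditions say that the ideal
    generated by the squarefree monomials of the complements keeps having
    linear quotients:
    - [shelling_stepP]: for an arbitrary family of faces, the shelling
      condition at [F] becomes [linear_quotient] on complements;
    - [simplicial_deletionsP]: [e] is simplicial over the complete clutter with
      the members of [s] deleted exactly when [linear_quotient s e].

    Hence a partial shelling yields a sequence of simplicial deletions from the
    complete clutter, whose result is decomposable
    ([decomposable_deletions]), and so chordal by hypothesis.  Chordality
    provides further simplicial deletions that lead to the empty clutter; each
    of them deletes at least one circuit, so no subset is deleted twice.  Over
    the empty clutter every [(d-1)]-subset is simplicial, so all the remaining
    ones can be appended in any order ([chordal_extension]).  Taking
    complements back gives the required extension of the shelling. *)

Set Implicit Arguments.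
Unset Strict Implicit.
Unset Printing Implicit Defensive.

(** * Linear quotients *)

Section LinearQuotients.

Variable T : finType.
Implicit Types (e x y F G H : {set T}) (s t : seq {set T}).

(** The colon ideal of the monomials of [s] by the monomial of [e] is generated
    by variables: each generator [x :\: e] is divisible by some variable [c]
    which is itself in the colon ideal. *)
Definition linear_quotient s e : Prop :=
  forall x, x \in s ->
    exists c, [/\ c \in x, c \notin e & exists2 y, y \in s & y \subset c |: e].

Definition linear_quotient_order s : Prop :=
  forall i, i < size s -> linear_quotient (take i s) (nth set0 s i).

Lemma linear_quotient_order_rcons s e :
  linear_quotient_order s -> linear_quotient s e ->
  linear_quotient_order (rcons s e).
Proof.
move=> lqs lqe i; rewrite size_rcons ltnS leq_eqVlt => /orP[/eqP-> | lt_i].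
  by rewrite -cats1 take_size_cat // nth_cat ltnn subnn.
by rewrite -cats1 takel_cat ?(ltnW lt_i) // nth_cat lt_i; apply: lqs.
Qed.

(** * Shelling steps *)

Lemma max_proper_facesP F G :
  reflect (exists2 c, c \in F & G = F :\ c) (G \in max_proper_faces F).
Proof.
rewrite inE; apply: (iffP maxsetP) => [[GF maxG] | [c cF ->]].
  have /properP[sGF [c cF cG]] := GF.
  exists c => //; apply/esym/maxG; first exact: properD1.
  by rewrite subsetD1 sGF.
split=> [|H HF sFH]; first exact: properD1.
have /properP[sHF [a aF aH]] := HF.
have ac : a = c.
  by apply: contraNeq aH => ac; apply: (subsetP sFH); rewrite !inE ac.
by apply/eqP; rewrite eqEsubset sFH andbT subsetD1 sHF -ac.
Qed.

Lemma complex_ofP (S : {set {set T}}) F :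
  reflect (exists2 G, G \in S & F \subset G) (F \in complex_of S).
Proof. by rewrite inE; apply: exists_inP. Qed.

(** If [G] is an earlier facet, then [G :&: F] must lie in a maximal proper
    face [F :\ c] which is contained in an earlier facet [H].  The element [c]
    avoids [G], and the complement of [H] is contained in [c |: ~: F].
    Conversely, the faces [F :\ c] that arise in this way generate the
    intersection, and there is one as soon as there is an earlier facet. *)
Lemma shelling_stepP s F :
  (exists S : {set {set T}},
     [/\ S != set0, S \subset max_proper_faces F
       & complex_of [set G in s] :&: complex_of [set F] = complex_of S])
  <-> s != [::] /\ linear_quotient (map (@setC T) s) (~: F).
Proof.
split=> [[S [/set0Pn[X XS] /subsetP maxS eqS]] | [s0 lq]].
  have inA Y : Y \in S -> exists2 H, H \in s & Y \subset H.
    move=> YS; have : Y \in complex_of S by apply/complex_ofP; exists Y.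
    by rewrite -eqS => /setIP[/complex_ofP[H]]; rewrite inE; exists H.
  split; first by have [H] := inA X XS; case: (s).
  move=> _ /mapP[G Gs ->].
  have /complex_ofP[Y YS sGY] : G :&: F \in complex_of S.
    rewrite -eqS inE; apply/andP; split; apply/complex_ofP.
      by exists G; rewrite ?inE ?subsetIl.
    by exists F; rewrite ?inE ?subsetIr.
  have /max_proper_facesP[c cF defY] := maxS Y YS.
  have [H Hs sYH] := inA Y YS.
  exists c; rewrite !inE cF; split=> //.
    apply/negP=> cG; have := subsetP sGY c.
    by rewrite defY !inE cG cF eqxx => /(_ isT).
  exists (~: H); first exact: map_f.
  by rewrite -setCS setCK setCU setCK setIC -setDE -defY.
have sub_dual c H : (~: H \subset c |: ~: F) = (F :\ c \subset H).
  by rewrite -setCS setCK setCU setCK setIC -setDE.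
have step G : G \in s ->
    exists c, [/\ c \in F, c \notin G & exists2 H, H \in s & F :\ c \subset H].
  move=> Gs; have [|c [cG cF [_ /mapP[H Hs ->] sH]]] := lq (~: G).
    exact: map_f.
  move: cG cF; rewrite !inE negbK => cG cF; exists c; split=> //.
  by exists H; rewrite -?sub_dual.
pose S := [set F :\ c | c in F & has (fun H : {set T} => F :\ c \subset H) s].
have inS c H : c \in F -> H \in s -> F :\ c \subset H -> F :\ c \in S.
  move=> cF Hs sFH; apply: imset_f; rewrite !inE cF.
  by apply/hasP; exists H.
exists S; split.
- case: s s0 step @S inS {lq} => // G s _ step S inS.
  have [|c [cF _ [H Hs sFH]]] := step G; first exact: mem_head.
  by apply/set0Pn; exists (F :\ c); apply: inS Hs sFH.
- apply/subsetP=> _ /imsetP[c /setIdP[cF _] ->].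
  by apply/max_proper_facesP; exists c.
- apply/setP=> X; rewrite inE; apply/andP/complex_ofP.
    case=> /complex_ofP[G]; rewrite inE => Gs sXG.
    case/complex_ofP=> _ /set1P-> sXF.
    have [c [cF cG [H Hs sFH]]] := step G Gs.
    exists (F :\ c); first exact: inS Hs sFH.
    by rewrite subsetD1 sXF; apply: contraNN cG; apply: (subsetP sXG).
  case=> _ /imsetP[c /setIdP[cF /hasP[H Hs sFH]] ->] sX.
  split; apply/complex_ofP.
    by exists H; rewrite ?inE //; apply: subset_trans sFH.
  by exists F; rewrite ?set11 //; apply: subset_trans (subD1set F c).
Qed.

Lemma facets_skeleton k : k < #|T| ->
  facets (skeleton k (complex_of [set [set: T]])) = ksubsets [set: T] k.+1.
Proof.
move=> ltkT.
have skE F : (F \in skeleton k (complex_of [set [set: T]])) = (#|F| <= k.+1).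
  rewrite inE; suff -> : F \in complex_of [set [set: T]] by [].
  by apply/complex_ofP; exists setT; rewrite ?set11 ?subsetT.
apply/setP=> F; rewrite !inE subsetT /=.
apply/maxsetP/eqP; rewrite skE; last first.
  move=> cF; split=> [|G]; first by rewrite cF.
  by rewrite skE => cG sFG; apply/eqP; rewrite eq_sym eqEcard sFG cF.
case=> leF maxF; apply/eqP; rewrite eqn_leq leF /= ltnNge; apply/negP=> leFk.
have /subsetPn[c _ cF] : ~~ ([set: T] \subset F).
  apply: contraL (leq_ltn_trans leFk ltkT) => /subset_leq_card.
  by rewrite cardsT leqNgt.
have := maxF (c |: F); rewrite skE cardsU1 cF ltnS.
move=> /(_ leFk (subsetUr _ _)) eqF.
by move: cF; rewrite -eqF setU11.
Qed.

(** * Deletions from the complete clutter *)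

Lemma in_deletions (C : {set {set T}}) s F :
  (F \in foldl (@deletion T) C s)
    = (F \in C) && all (fun x => ~~ (x \subset F)) s.
Proof.
elim: s C => [|x s IHs] C /=; first by rewrite andbT.
by rewrite IHs inE andbA.
Qed.

Variables (d : nat) (d_gt0 : 0 < d).

Definition deletions s : {set {set T}} :=
  foldl (@deletion T) (complete_clutter d [set: T]) s.

Lemma mem_deletions s F :
  (F \in deletions s) = (#|F| == d) && all (fun x => ~~ (x \subset F)) s.
Proof. by rewrite in_deletions inE subsetT. Qed.

Lemma deletions_rcons s e : deletions (rcons s e) = deletion (deletions s) e.
Proof. by rewrite /deletions foldl_rcons. Qed.

Lemma mem_closed_nbhd s e c : e \in ksubsets [set: T] d.-1 ->
  (c \in closed_nbhd [set: T] (deletions s) e)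
    = (c \in e) || all (fun x => ~~ (x \subset c |: e)) s.
Proof.
rewrite inE subsetT /= => /eqP card_e.
rewrite !inE; case: (boolP (c \in e)) => //= ce.
by rewrite setUC mem_deletions cardsU1 ce card_e add1n prednK ?eqxx.
Qed.

(** A vertex outside [e] misses the closed neighbourhood [N] of [e] exactly
    when it is one of the variables in the colon ideal, and [N] is a clique
    exactly when it contains no [x] in [s]: if [x \subset N], adding to [x] an
    element of [e :\: x] gives a [d]-subset of [N] containing [x]. *)
Lemma simplicial_deletionsP s e :
  {subset s <= ksubsets [set: T] d.-1} -> e \in ksubsets [set: T] d.-1 ->
  e \notin s ->
  simplicial d [set: T] (deletions s) e <-> linear_quotient s e.
Proof.
move=> ss e_sub es; set N := closed_nbhd [set: T] (deletions s) e.
have NE c : (c \in N) = (c \in e) || all (fun x => ~~ (x \subset c |: e)) s.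
  exact: mem_closed_nbhd.
have card_e : #|e| = d.-1 by move: e_sub; rewrite inE subsetT /= => /eqP.
split=> [[_ [_ clN]] x xs | lq]; last first.
  split=> //; split; first exact: subsetT.
  right; apply/subsetP=> Y; rewrite inE => /andP[sYN cardY].
  rewrite mem_deletions cardY; apply/allP=> x xs.
  have [c [cx ce [y ys sy]]] := lq x xs.
  apply/negP=> /subsetP/(_ c cx)/(subsetP sYN).
  by rewrite NE (negPf ce) => /allP/(_ y ys); rewrite sy.
have card_x : #|x| = d.-1.
  by have := ss x xs; rewrite inE subsetT /= => /eqP.
have /subsetPn[c cx cN] : ~~ (x \subset N).
  apply/negP=> sxN.
  have /subsetPn[a ae ax] : ~~ (e \subset x).
    apply: contraNN es => sex; suff -> : e = x by [].
    by apply/eqP; rewrite eqEcard sex card_x card_e leqnn.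
  have cardY : #|a |: x| = d by rewrite cardsU1 ax card_x add1n prednK.
  have sYN : a |: x \subset N by rewrite subUset sxN andbT sub1set NE ae.
  case: clN => [|/subsetP/(_ (a |: x))].
    by rewrite ltnNge -cardY subset_leq_card.
  rewrite inE sYN cardY eqxx mem_deletions => /(_ isT)/andP[_ /allP/(_ x xs)].
  by rewrite subsetUr.
move: cN; rewrite NE negb_or -has_predC => /andP[ce /hasP[y ys]].
by rewrite /= negbK => sy; exists c; split=> //; exists y.
Qed.

(** In a simplicial subclutter one may remove any circuits through a simplicial
    subcircuit; here all of them are removed, so that the set differences are
    deletions. *)
Lemma decomposable_deletions s :
  uniq s -> {subset s <= ksubsets [set: T] d.-1} -> linear_quotient_order s ->
  decomposable d [set: T] (deletions s).
Proof.
move=> us ss lqs; set K := complete_clutter d [set: T].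
have [-> | neqK] := eqVneq (deletions s) K; first exact: decomposable_complete.
apply: (decomposable_simplicial (decomposable_complete d [set: T])).
pose A i :=
  [set F in foldl (@deletion T) K (take i s) | nth set0 s i \subset F].
pose As := mkseq A (size s).
have eq_fold i : i <= size s ->
    foldl (fun X Y => X :\: Y) K (take i As) = deletions (take i s).
  elim: i => [|i IHi] lti; first by rewrite !take0.
  rewrite !(take_nth set0) ?size_mkseq // deletions_rcons foldl_rcons.
  rewrite IHi ?(ltnW lti) // nth_mkseq //.
  by apply/setP=> F; rewrite !inE -/K; case: (F \in _); rewrite ?andbF ?andbT.
split.
  rewrite properEneq neqK; apply/subsetP=> F.
  by rewrite in_deletions => /andP[].
exists s, As; split; first by rewrite size_mkseq.
  move=> i lti; have es := ss _ (mem_nth set0 lti).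
  split=> //; first by rewrite nth_mkseq.
  rewrite eq_fold ?(ltnW lti) //.
  apply/simplicial_deletionsP=> //; last exact: lqs.
    by move=> x /mem_take /ss.
  by rewrite in_take ?mem_nth // index_uniq // ltnn.
by rewrite -[in LHS](take_size s) -eq_fold // take_oversize ?size_mkseq.
Qed.

(** * Extending an order by chordality *)

(** Over the empty clutter every closed neighbourhood is trivial, so every
    [(d-1)]-subset is simplicial, and further deletions change nothing. *)
Lemma linear_quotient_order_cat s t :
  deletions s = set0 -> linear_quotient_order s -> uniq (s ++ t) ->
  {subset s ++ t <= ksubsets [set: T] d.-1} -> linear_quotient_order (s ++ t).
Proof.
elim: t s => [|e t IHt] s ds lqs; first by rewrite cats0.
rewrite -cat_rcons => ust sst; apply: IHt => //.
  by apply/setP=> F; rewrite deletions_rcons ds !inE.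
have e_sub : e \in ksubsets [set: T] d.-1.
  by apply: sst; rewrite mem_cat mem_rcons mem_head.
apply: linear_quotient_order_rcons => //; apply/simplicial_deletionsP=> //.
- by move=> x xs; apply: sst; rewrite mem_cat mem_rcons inE xs orbT.
- by move: ust; rewrite cat_uniq rcons_uniq => /and3P[/andP[]].
split=> //; split; first exact: subsetT.
left; rewrite ds.
have -> : closed_nbhd [set: T] set0 e = e.
  by apply/setP=> c; rewrite !inE orbF.
by move: e_sub; rewrite inE => /andP[_ /eqP->]; rewrite prednK.
Qed.

(** Each deletion witnessing chordality removes a circuit, so the subset that
    it deletes is new; once no circuit is left, the subsets not yet listed
    follow in an arbitrary order. *)
Lemma chordal_extension s :
  chordal d [set: T] (deletions s) ->
  uniq s -> {subset s <= ksubsets [set: T] d.-1} -> linear_quotient_order s ->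
  exists t, [/\ uniq (s ++ t), s ++ t =i ksubsets [set: T] d.-1
              & linear_quotient_order (s ++ t)].
Proof.
move defC: (deletions s) => C chC.
elim: chC s defC => {C} [|C e maxe sime _ IHC] s defC us ss lqs.
  pose t := [seq x <- enum (ksubsets [set: T] d.-1) | x \notin s].
  have eq_st : s ++ t =i ksubsets [set: T] d.-1.
    move=> x; rewrite mem_cat mem_filter mem_enum.
    by case: (boolP (x \in s)) => //= /ss ->.
  have ust : uniq (s ++ t).
    rewrite cat_uniq us filter_uniq ?enum_uniq // andbT /=.
    by apply/hasPn=> x; rewrite mem_filter => /andP[].
  exists t; split=> //; apply: linear_quotient_order_cat => // x.
  by rewrite eq_st.
have [e_sub Ne] := maxe.
have es : e \notin s.
  (* a subset deleted earlier lies in no circuit, so it is not maximal *)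
  apply/negP=> es; apply: Ne; apply/setP=> c; rewrite -defC mem_closed_nbhd //.
  case: (c \in e) => //=; apply/negbTE/allPn.
  by exists e; rewrite ?negbK ?subsetUr.
have [|||| t [ust eqt lqt]] := IHC (rcons s e).
- by rewrite deletions_rcons defC.
- by rewrite rcons_uniq es.
- by move=> x; rewrite mem_rcons inE => /predU1P[->|/ss].
- apply: linear_quotient_order_rcons => //.
  by apply/simplicial_deletionsP=> //; rewrite defC.
by exists (e :: t); rewrite -cat_rcons.
Qed.

End LinearQuotients.

(** * Extendable shellability *)

Theorem corollary3p7 (d : nat) (hd : 0 < d)
  (hdec : forall (T : finType) (V : {set T}) (C : {set {set T}}),
     uniform_clutter d V C -> decomposable d V C -> chordal d V C)
  (n : nat) (hn : d <= n) :
  extendably_shellable (skeleton (n - d) (complex_of [set [set: 'I_n]])).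
Proof.
set Delta := skeleton _ _ => Gamma Fs _ _ sub_facets [uFs eqFs shFs].
have facetsE F : (F \in facets Delta) = (~: F \in ksubsets [set: 'I_n] d.-1).
  rewrite facets_skeleton ?card_ord; last by rewrite ltn_subrL hd (leq_trans hd).
  rewrite !inE !subsetT /= [#|~: F|]cardsCs setCK card_ord.
  have := max_card (mem F); rewrite card_ord => leF.
  move: #|F| leF => k lekn.
  by apply/eqP/eqP; lia.
pose s := map (@setC 'I_n) Fs.
have ss : {subset s <= ksubsets [set: 'I_n] d.-1}.
  move=> _ /mapP[F FFs ->]; rewrite -facetsE.
  by apply: (subsetP sub_facets); rewrite -eqFs.
have us : uniq s by rewrite map_inj_uniq //; apply: setC_inj.
have lqs : linear_quotient_order s.
  move=> [_ x|i]; first by rewrite take0.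
  rewrite size_map => lti; rewrite (nth_map set0) // -map_take.
  by have /shelling_stepP[] := shFs i.+1 lti.
have decs := decomposable_deletions hd us ss lqs.
have [|t [ust eqt lqt]] := chordal_extension hd _ us ss lqs.
  apply: hdec decs; split.
    split=> [F _|F G]; first exact: subsetT.
    rewrite !mem_deletions => /andP[/eqP cF _] /andP[/eqP cG _] sFG.
    by apply/eqP; rewrite eqEcard sFG cF cG leqnn.
  by move=> F; rewrite mem_deletions => /andP[/eqP].
exists (map (@setC 'I_n) t).
set Hs := Fs ++ _.
have stE : s ++ t = map (@setC 'I_n) Hs.
  by rewrite map_cat (mapK (@setCK 'I_n)).
split.
- by rewrite -(map_inj_uniq (@setC_inj 'I_n)) -stE.
- by move=> F; rewrite facetsE -eqt stE mem_map //; apply: setC_inj.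
move=> i /andP[i_gt0 lti]; apply/shelling_stepP; split.
  by rewrite -size_eq0 size_takel ?(ltnW lti) // -lt0n.
have := lqt i; rewrite stE size_map (nth_map set0) // -map_take.
exact.
Qed.
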